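(* There exist absolute constants $a_0, a_1 > 0$ (independent of $n$, $d$, $c$ and $K$) such that the following holds. Let $n, d \geq 1$ be integers, let $c > 1$ be a real constant, let $r = (x_1^2 + x_2^2 + \cdots + x_n^2)^d$, and suppose $K$ is a polytope in $P_{n,2d}$ with $$ \widetilde{P}os_{n,2d} - r \subseteq K \subseteq c^{d} \left( \widetilde{P}os_{n,2d} - r \right). $$ Then $K$ has at least $$ a_0 e^{a_1 \frac{n}{cd}} $$ facets.
   Context: $P_{n,2d}$ is the vector space of real homogeneous polynomials of degree $2d$ in $n$ variables. $S^{n-1}$ is the Euclidean unit sphere in $\mathbb{R}^n$ and $\sigma$ is the uniform (rotation invariant) measure on it with $\sigma(S^{n-1}) = 1$. Set $Pos_{n,2d} = \{ f \in P_{n,2d} : f(x) \geq 0 \text{ for all } x \in S^{n-1} \}$ and $\widetilde{P}os_{n,2d} = \{ f \in Pos_{n,2d} : \int_{S^{n-1}} f \, d\sigma = 1 \}$. For a set $A \subseteq P_{n,2d}$, $A - r = \{ f - r : f \in A \}$. A polytope is the convex hull of finitely many points; it may lie in a proper affine subspace of $P_{n,2d}$, and its facets are its faces of codimension one relative to its affine hull. *)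

(* Defs.v *)
From HB Require Import structures.
From mathcomp Require Import all_boot all_order all_algebra.
(* The notations of mpoly clash with those of the analysis library unless mpoly
   is imported first. *)
From mathcomp Require Import mpoly.
From mathcomp Require Import all_classical all_reals all_analysis.

Set Implicit Arguments.
Unset Strict Implicit.
Unset Printing Implicit Defensive.

Import Order.TTheory GRing.Theory Num.Theory.
Import numFieldNormedType.Exports.

Local Open Scope classical_set_scope.
Local Open Scope ring_scope.

Section Polytopes.
Context {R : realType} {V : lmodType R}.
Implicit Types A K F : set V.

Definition conv_hull A : set V := [set x |
  exists m (p : 'I_m -> V) (t : 'I_m -> R),
  [/\ forall i, A (p i), forall i, 0 <= t i, \sum_i t i = 1
    & x = \sum_i t i *: p i]].

Definition aff_hull A : set V := [set x |
  exists m (p : 'I_m -> V) (t : 'I_m -> R),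
  [/\ forall i, A (p i), \sum_i t i = 1 & x = \sum_i t i *: p i]].

Definition aff_indep m (p : 'I_m -> V) : Prop :=
  forall t : 'I_m -> R,
    \sum_i t i = 0 -> \sum_i t i *: p i = 0 -> forall i, t i = 0.

(* The affine hull of A is spanned by k + 1 affinely independent points; in
   particular the empty set has dimension -1. *)
Definition affine_dim A (k : int) : Prop := exists m (p : 'I_m -> V),
  [/\ aff_indep p, aff_hull A = aff_hull (range p) & k = m%:Z - 1].

Definition polytope K : Prop := exists2 A, finite_set A & K = conv_hull A.

(* The improper faces K and set0 are included, so that a polytope reduced to a
   point has exactly one facet, namely set0. *)
Definition face K F : Prop := exists (l : {scalar V}) (b : R),
  (forall x, K x -> l x <= b) /\ F = [set x | K x /\ l x = b].

Definition facet K F : Prop :=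
  face K F /\ exists k, affine_dim K k /\ affine_dim F (k - 1).

Definition translate A (v : V) : set V := [set x - v | x in A].

Definition dilate (a : R) A : set V := [set a *: x | x in A].

End Polytopes.

Section Sphere.
Context {R : realType} (n : nat).

(* R^n with its Borel sigma-algebra *)
Definition borel_rV := g_sigma_algebraType (@open 'rV[R]_n).
HB.instance Definition _ := Measurable.on borel_rV.

(* The library norm on row vectors is the sup norm. *)
Definition euclid_sphere : set borel_rV :=
  [set x : 'rV[R]_n | \sum_i x 0 i ^+ 2 = 1].

(* Carried by the sphere, of mass 1 and invariant under every orthogonal matrix:
   these properties determine sigma.  For n = 1 this needs the orthogonal group
   rather than the special one. *)
Definition uniform_on_sphere (sigma : {measure set borel_rV -> \bar R}) : Prop :=
  [/\ sigma euclid_sphere = 1%E, sigma (~` euclid_sphere) = 0%E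
    & forall Q : 'M[R]_n, Q *m Q^T = 1%:M ->
      forall A : set borel_rV, measurable A ->
        sigma [set x : 'rV[R]_n | A (x *m Q)] = sigma A].

End Sphere.
Arguments borel_rV : clear implicits.
Arguments euclid_sphere : clear implicits.

Section Forms.
Context {R : realType} (n d : nat).

Definition hform := dhomog n R d.
HB.instance Definition _ := GRing.Lmodule.on hform.

Definition hform_eval (f : hform) (x : 'rV[R]_n) : R :=
  (f : {mpoly R[n]}).@[fun i => x 0 i].

End Forms.
Arguments hform : clear implicits.

Section NonnegativeForms.
Context {R : realType} (n d : nat).

Lemma sumsq_pow_homog :
  (\sum_(i < n) 'X_i ^+ 2 : {mpoly R[n]}) ^+ d \is (2 * d).-homog.
Proof.
apply: dhomogMn; apply: rpred_sum => i _.
by rewrite -[2%N]mul1n; apply: dhomogMn; rewrite dhomogX /= mdeg1.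
Qed.

Definition sumsq_pow : hform R n (2 * d) := DHomog sumsq_pow_homog.

Definition Pos_hform : set (hform R n (2 * d)) :=
  [set f | forall x : 'rV[R]_n, euclid_sphere R n x -> 0 <= hform_eval f x].

Definition Pos1_hform (sigma : {measure set (borel_rV R n) -> \bar R}) :
    set (hform R n (2 * d)) :=
  [set f | Pos_hform f /\
    (\int[sigma]_(x in euclid_sphere R n) (hform_eval f x)%:E)%E = 1%E].

End NonnegativeForms.
Arguments sumsq_pow : clear implicits.
Arguments Pos_hform : clear implicits.
Arguments Pos1_hform {R} n d sigma.

(* Main.v *)
(* K lies in the hyperplane M of forms of mean 0 and contains a neighbourhood of
   0 in M, so K = {x in M : l_i x <= 1, i < N} with N minimal, and the N sets
   {x in K : l_i x = 1} are distinct facets.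

   Let r be the form |x|^(2d) and E f the mean of f over the sphere.  As K
   contains Pos1 - r, the functional L_i f = E f - l_i (f - (E f) r) is
   nonnegative on nonnegative forms and L_i r = 1.  For a unit vector v put
   q_v x = (v . x)^(2d) and G_i v = L_i q_v.  By convexity the mean of G_i^k
   over the sphere is at most gamma_(dk), where gamma_m is the mean of v_0^(2m)
   and gamma_m <= (2m/n)^m.  If N * gamma_(dk) < c^(-dk), some v has
   G_i v < c^(-d) for all i, hence (gamma_d r - q_v) / (c^(-d) - gamma_d) lies
   in K; but its value at v is below -c^d, so K is not contained in
   c^d (Pos1 - r).  Hence N >= (n / (2dkc))^(dk), and k is chosen to be
   the integer part of n / (2ecd). *)

Require Import Defs.
From HB Require Import structures.
From mathcomp Require Import all_boot all_order all_algebra.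
From mathcomp Require Import mpoly.
From mathcomp Require Import all_classical all_reals all_analysis.
From mathcomp Require Import measurable_realfun.
From mathcomp Require Import zify ring lra.

Set Implicit Arguments.
Unset Strict Implicit.
Unset Printing Implicit Defensive.

Import Order.TTheory GRing.Theory Num.Theory.
Import numFieldNormedType.Exports.

Local Open Scope classical_set_scope.
Local Open Scope card_scope.
Local Open Scope ring_scope.

(** * Polyhedral description of polytopes *)

Section Cone.
Context {R : realType} {V : vectType R}.
Implicit Types (ps : seq V) (c : 'Hom(V, R^o) * R).

(** Eliminates one unknown that must itself be nonnegative: the maximum of 0 and the lower bounds
    works. *)
Lemma exists_between (lo hi : seq R) :
  all (>= 0) hi -> allrel <=%R lo hi ->
  exists t, [/\ 0 <= t, all (<= t) lo & all (>= t) hi].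
Proof.
move=> hi0; elim: lo => [|a lo IH]; first by exists 0.
rewrite allrel_consl => /andP[ahi /IH[t [t0 lot hit]]].
exists (Num.max a t); split=> /=.
- by rewrite le_max t0 orbT.
- rewrite le_max lexx /=; apply: sub_all lot => x /= xt.
  by rewrite le_max xt orbT.
- apply/allP => x xhi /=.
  by rewrite ge_max (allP ahi _ xhi) (allP hit _ xhi).
Qed.

(* (x, s) lies in the cone of V * R spanned by the (p, 1), p in ps, so that the
   slice s = 1 is the convex hull of ps. *)
Fixpoint in_cone ps (x : V) (s : R) : Prop :=
  if ps is p :: ps' then exists2 t, 0 <= t & in_cone ps' (x - t *: p) (s - t)
  else x = 0 /\ s = 0.

(** The pair [c] encodes the homogeneous halfspace c.1 x <= c.2 * s; despite the name, points inside
    it have nonpositive [slack]. *)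
Definition slack (x : V) (s : R) c : R := c.1 x - c.2 * s.

Lemma slackB x y s t c : slack (x - y) (s - t) c = slack x s c - slack y t c.
Proof. by rewrite /slack linearB /=; ring. Qed.

Lemma slackZ a x s c : slack (a *: x) (a * s) c = a * slack x s c.
Proof. by rewrite /slack linearZ /= /GRing.scale /=; ring. Qed.

(* Fourier-Motzkin elimination of the coefficient of the head of the list. *)
Lemma in_cone_halfspaces ps : exists cs : seq ('Hom(V, R^o) * R),
  forall x s, in_cone ps x s <-> {in cs, forall c, slack x s c <= 0}.
Proof.
elim: ps => [|p ps [cs csP]].
  (* The zero cone: every coordinate of x, and s itself, is constrained with both signs. *)
  pose b := vbasis (@fullv R V).
  pose e i : 'Hom(V, R^o) := linfun (coord b i : V -> R^o).
  pose cs : seq ('Hom(V, R^o) * R) := (0, 1) :: (0, -1) ::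
    [seq (e i, 0) | i <- enum 'I_(\dim (@fullv R V))] ++
    [seq (- e i, 0) | i <- enum 'I_(\dim (@fullv R V))].
  exists cs => x s; split=> [/= [-> ->] c _|H].
    by rewrite /slack linear0 mulr0 subr0.
  split.
    rewrite (coord_vbasis (memvf x)) big1 // => i _.
    suff -> : coord b i x = 0 by rewrite scale0r.
    apply/eqP; rewrite eq_le.
    have /H : (e i, 0) \in cs.
      by rewrite !inE mem_cat (map_f (fun i => (e i, 0 : R))) ?mem_enum // !orbT.
    have /H : (- e i, 0) \in cs.
      by rewrite !inE mem_cat (map_f (fun i => (- e i, 0 : R))) ?mem_enum // !orbT.
    rewrite /slack /= opp_lfunE lfunE /= !mul0r !subr0 oppr_le0 => -> ->.
    by [].
  have := H (0, 1); have := H (0, -1).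
  rewrite !inE !eqxx /= !orbT => /(_ isT) + /(_ isT).
  by rewrite /slack /= !lfunE /= => ? ?; lra.
(* Subtracting t copies of [p] lowers the slack of [c] by t * [w c], so [c] bounds t from below when
   [w c] is positive and from above when it is negative; [comb] cancels t between two opposite
   bounds. *)
pose w := slack p 1.
pose comb c c' : 'Hom(V, R^o) * R :=
  (w c *: c'.1 - w c' *: c.1, w c * c'.2 - w c' * c.2).
have slack_comb x s c c' :
    slack x s (comb c c') = w c * slack x s c' - w c' * slack x s c.
  by rewrite /slack /comb /= !lfunE /= !lfunE /= lfunE /= /GRing.scale /=; ring.
pose pos := [seq c <- cs | 0 < w c]; pose neg := [seq c <- cs | w c < 0].
(* Constraints with negative [w c] are also kept uncombined: they say that the upper bounds on t are
   nonnegative, as t >= 0 demands. *)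
exists ([seq c <- cs | w c <= 0] ++ [seq comb c c' | c <- pos, c' <- neg]) => x s.
have coneE t : in_cone ps (x - t *: p) (s - t) <->
    {in cs, forall c, slack x s c <= t * w c}.
  by rewrite csP; split=> H c /H;
    rewrite -[X in slack _ (s - X)]mulr1 slackB slackZ -/(w c) subr_le0.
split=> /= [[t t0 /coneE Ht] c|H].
  rewrite mem_cat => /orP[|/allpairsP[[c1 c2] /= []]].
    rewrite mem_filter => /andP[wc /Ht] /le_trans; apply.
    by rewrite mulr_ge0_le0.
  rewrite !mem_filter => /andP[w1 /Ht h1] /andP[w2 /Ht h2] ->.
  rewrite slack_comb.
  have : w c1 * slack x s c2 <= w c1 * (t * w c2) by rewrite ler_pM2l.
  have : w c2 * (t * w c1) <= w c2 * slack x s c1 by rewrite ler_nM2l.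
  lra.
have [||t [t0 lot hit]] := @exists_between [seq slack x s c / w c | c <- pos]
    [seq slack x s c / w c | c <- neg].
- apply/allP => _ /mapP[c + ->]; rewrite mem_filter => /andP[wc cs_c] /=.
  rewrite -mulrNN -invrN mulr_ge0 // ?invr_ge0 ?oppr_ge0 ?(ltW wc) //.
  by apply: H; rewrite mem_cat mem_filter (ltW wc) cs_c.
- apply/allrelP => _ _ /mapP[c cpos ->] /mapP[c' cneg ->].
  have := H (comb c c'); rewrite mem_cat allpairs_f // orbT => /(_ isT).
  rewrite slack_comb.
  move: cpos cneg; rewrite !mem_filter => /andP[wc _] /andP[wc' _] h.
  rewrite ler_pdivrMr // mulrAC ler_ndivlMr //; lra.
exists t => //; apply/coneE => c cs_c.
have [wc|wc|wc] := ltrgtP 0 (w c).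
- have /(allP lot) : slack x s c / w c \in [seq slack x s c / w c | c <- pos].
    by apply: (map_f (fun c => slack x s c / w c)); rewrite mem_filter wc.
  by move=> /=; rewrite ler_pdivrMr.
- have /(allP hit) : slack x s c / w c \in [seq slack x s c / w c | c <- neg].
    by apply: (map_f (fun c => slack x s c / w c)); rewrite mem_filter wc.
  by move=> /=; rewrite ler_ndivlMr.
- rewrite -wc mulr0; apply: H.
  by rewrite mem_cat mem_filter -wc lexx cs_c.
Qed.

Lemma in_cone0 ps : in_cone ps 0 0.
Proof.
by elim: ps => [|p ps IH] //=; exists 0; rewrite // scale0r !subr0.
Qed.

Lemma in_coneD ps x y s t :
  in_cone ps x s -> in_cone ps y t -> in_cone ps (x + y) (s + t).
Proof.
elim: ps x y s t => [|p ps IH] x y s t /=.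
  by move=> [-> ->] [-> ->]; rewrite !addr0.
move=> [a a0 xs] [b b0 yt]; exists (a + b); first exact: addr_ge0.
have := IH _ _ _ _ xs yt.
by rewrite scalerDl !opprD addrACA (addrACA s).
Qed.

Lemma in_cone_mem ps p t : p \in ps -> 0 <= t -> in_cone ps (t *: p) t.
Proof.
elim: ps => [|q ps IH] //=; rewrite inE => /orP[/eqP <- t0|pps t0].
  by exists t => //; rewrite !subrr; exact: in_cone0.
by exists 0; rewrite // scale0r !subr0; exact: IH.
Qed.

Lemma in_coneP ps x s : in_cone ps x s -> exists t : 'I_(size ps) -> R,
  [/\ forall i, 0 <= t i, \sum_i t i = s & x = \sum_i t i *: ps`_i].
Proof.
elim: ps x s => [|p ps IH] x s /=.
  by move=> [-> ->]; exists (fun=> 0); rewrite !big_ord0; split.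
move=> [a a0 /IH[t [t0 ts xE]]].
exists (fun i => oapp t a (unlift ord0 i)); split.
- by move=> i; case: unliftP => [j|] _ /=.
- rewrite big_ord_recl unlift_none /= -[RHS](subrK a) -ts addrC; congr (_ + _).
  by apply: eq_bigr => i _; rewrite liftK.
- rewrite big_ord_recl unlift_none /= -[LHS](subrK (a *: p)) xE addrC.
  by congr (_ + _); apply: eq_bigr => i _; rewrite liftK.
Qed.

Lemma polytope_halfspaces (K : set V) : polytope K ->
  exists cs : seq ('Hom(V, R^o) * R),
    forall x, K x <-> {in cs, forall c, c.1 x <= c.2}.
Proof.
case=> A /finite_seqP[ps ->] ->; have [cs csP] := in_cone_halfspaces ps.
exists cs => x; rewrite (_ : {in cs, _} <-> {in cs, forall c, slack x 1 c <= 0}).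
  rewrite -csP; split=> [[m [p [t [Ap t0 t1 ->]]]]|/in_coneP[t [t0 t1 ->]]].
    rewrite -t1; apply: (big_ind2 (in_cone ps)) => [||i _].
    - exact: in_cone0.
    - by move=> x1 y1 x2 y2; exact: in_coneD.
    - by apply: in_cone_mem => //; exact: Ap.
  exists (size ps), (fun i => ps`_i), t; split=> // i /=.
  by rewrite mem_nth.
by split=> H c /H; rewrite /slack mulr1 subr_le0.
Qed.

End Cone.

(** * Facets *)

Section Facets.
Context {R : realType} {V : vectType R}.
Implicit Types (A K : set V) (M W : {vspace V}).

(** [face] asks for a functional into R, while [l] takes values in R^o; this copy carries the
    required linear structure. *)
Definition scalar_of (l : 'Hom(V, R^o)) : V -> R := l.

Lemma scalar_of_linear l : linear_for *%R (scalar_of l).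
Proof. by move=> a x y; rewrite /scalar_of linearP. Qed.

HB.instance Definition _ (l : 'Hom(V, R^o)) :=
  GRing.isLinear.Build R V R *%R (scalar_of l) (scalar_of_linear l).

Lemma aff_hull_line A p q s :
  A p -> A q -> aff_hull A (p + s *: (q - p)).
Proof.
move=> Ap Aq.
exists 2%N, (fun i : 'I_2 => if i == ord0 then p else q),
  (fun i : 'I_2 => if i == ord0 then 1 - s else s); split.
- by move=> i; case: ifP.
- by rewrite !big_ord_recl big_ord0 /=; ring.
- rewrite !big_ord_recl big_ord0 /= addr0 scalerBr scalerBl scale1r.
  by rewrite addrA addrAC.
Qed.

Lemma aff_hull_sub A z W : A `<=` [set x | x - z \in W] ->
  aff_hull A `<=` [set x | x - z \in W].
Proof.
move=> AW x [m [p [t [Ap t1 ->]]]] /=.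
rewrite -[z]scale1r -t1 scaler_suml -sumrB memv_suml // => i _.
by rewrite -scalerBr memvZ // AW.
Qed.

(** The affinely independent points are z, placed at index [ord0], and the translates by z of a
    basis of W. *)
Lemma affine_dim_coset A z W :
  aff_hull A = [set x | x - z \in W] -> affine_dim A (\dim W)%:Z.
Proof.
move=> AE; pose b := vbasis W.
pose q (i : 'I_(\dim W).+1) := z + oapp (fun j : 'I_(\dim W) => b`_j) 0 (unlift ord0 i).
have sumq t : \sum_i t i *: q i = (\sum_i t i) *: z +
    \sum_(j < \dim W) t (lift ord0 j) *: b`_j.
  under eq_bigr do rewrite scalerDr.
  rewrite big_split /= -scaler_suml; congr (_ + _).
  rewrite big_ord_recl unlift_none /= scaler0 add0r.
  by apply: eq_bigr => j _; rewrite liftK.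
exists (\dim W).+1, q; split.
- move=> t t0; rewrite sumq t0 scale0r add0r => tb.
  have /freeP/(_ _ tb) tS : free b by exact: basis_free (vbasisP W).
  move=> i; case: (unliftP ord0 i) => [j ->|->]; first exact: tS.
  by move: t0; rewrite big_ord_recl big1 ?addr0 // => j _; exact: tS.
- rewrite AE; apply/seteqP; split.
    move=> x /coord_vbasis xE.
    pose c (j : 'I_(\dim W)) := coord b j (x - z).
    pose t i := oapp c (1 - \sum_j c j) (unlift ord0 i).
    have tS j : t (lift ord0 j) = c j by rewrite /t liftK.
    have t1 : \sum_i t i = 1.
      rewrite big_ord_recl (eq_bigr c) => [|j _]; last exact: tS.
      by rewrite /t unlift_none subrK.
    exists (\dim W).+1, q, t; split=> //.
    rewrite sumq t1 scale1r (eq_bigr (fun j => c j *: b`_j)) => [|j _].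
      by rewrite -xE addrC subrK.
    by rewrite tS.
  apply: aff_hull_sub => _ [i _ <-] /=; rewrite /q addrC addKr.
  case: unliftP => [j|] _ /=; last exact: mem0v.
  by apply: vbasis_mem; rewrite mem_nth // size_tuple.
- by rewrite -addn1 PoszD addrK.
Qed.

(** Allows a short move in any direction from a point where the inequalities in [P] are strict. The
    sum [S] dominates every ratio |b j| / (1 - a j), and its summand 1 keeps it positive when [P] is
    empty. *)
Lemma small_step N (a b : 'I_N -> R) (P : pred 'I_N) :
  (forall j, P j -> a j < 1) ->
  exists2 e, 0 < e & forall j, P j -> a j + e * b j <= 1.
Proof.
move=> a1; pose S := 1 + \sum_(j | P j) `|b j| / (1 - a j).
have term0 j : P j -> 0 <= `|b j| / (1 - a j).
  by move=> /a1 h; rewrite divr_ge0 // subr_ge0 ltW.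
have S0 : 0 < S by rewrite ltr_wpDr // sumr_ge0.
exists S^-1; first by rewrite invr_gt0.
move=> j Pj; rewrite addrC -lerBrDr mulrC ler_pdivrMr //.
apply: le_trans (ler_norm _) _.
rewrite mulrC -ler_pdivrMr ?subr_gt0 ?a1 // /S (bigD1 j) //= addrCA lerDl.
by rewrite addr_ge0 // sumr_ge0 // => i /andP[/term0].
Qed.

(** The point y violates inequality i alone, so y / l_i y lies on its hyperplane and strictly inside
    the others; near that point the face fills the section of M by the hyperplane. The witness z
    later tells facets apart. *)
Lemma irredundant_facet K M N (l : 'I_N -> 'Hom(V, R^o)) i y :
  K `<=` [set` M] ->
  (forall x, x \in M -> exists2 e, 0 < e & K (e *: x)) ->
  (forall x, x \in M -> K x <-> forall j, l j x <= 1) ->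
  y \in M -> (forall j, j != i -> l j y <= 1) -> 1 < l i y ->
  facet K [set x | K x /\ l i x = 1] /\
  exists z, [/\ K z, l i z = 1 & forall j, j != i -> l j z < 1].
Proof.
move=> KM Kabs Kl My ly liy.
have liy0 : 0 < l i y by exact: lt_trans liy.
pose z := (l i y)^-1 *: y.
have Mz : z \in M by exact: memvZ.
have liz : l i z = 1 by rewrite linearZ /= /GRing.scale /= mulVf // gt_eqF.
have ljz j : j != i -> l j z < 1.
  move=> ji; rewrite linearZ /= /GRing.scale /= mulrC ltr_pdivrMr // mul1r.
  exact: le_lt_trans (ly j ji) _.
have Kz : K z.
  by apply/Kl => // j; case: (eqVneq j i) => [->|/ljz/ltW//]; rewrite liz.
clearbody z; split; last by exists z.
have K0 : K 0 by have [e _] := Kabs 0 (mem0v _); rewrite scaler0.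
pose W := (M :&: lker (l i))%VS.
split.
  exists (scalar_of (l i) : {scalar V}), 1; split=> // x Kx.
  exact: (Kl x (KM x Kx)).1 Kx i.
(* K absorbs M, so the affine hull of K is M. *)
exists (\dim M)%:Z; split.
  apply: (@affine_dim_coset _ 0); apply/seteqP; split.
    by apply: aff_hull_sub => x /KM /=; rewrite subr0.
  move=> x /=; rewrite subr0 => Mx; have [e e0 Kex] := Kabs x Mx.
  have := aff_hull_line e^-1 K0 Kex.
  by rewrite add0r subr0 scalerA mulVf ?scale1r // gt_eqF.
(* Rank-nullity: [l i] is nonzero at z, so its kernel has codimension one in M. *)
have -> : (\dim M)%:Z - 1 = (\dim W)%:Z.
  rewrite -(limg_ker_dim (l i) M) PoszD.
  suff -> : (\dim (l i @: M) = 1)%N by rewrite addrK.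
  apply/eqP; rewrite eqn_leq lt0n dimv_eq0; apply/andP; split.
    by rewrite (leq_trans (dimvS (subvf _))) // dimvf.
  apply/eqP => img0; have := memv_img (l i) Mz.
  by rewrite img0 memv0 liz oner_eq0.
apply: (@affine_dim_coset _ z); apply/seteqP; split.
  apply: aff_hull_sub => x [/KM/= Mx lx].
  by rewrite memv_cap memvB // memv_ker linearB /= lx liz subrr eqxx.
move=> x /=; rewrite memv_cap memv_ker => /andP[Mxz /eqP lxz].
have [e e0 He] := @small_step N (fun j => l j z) (fun j => l j (x - z)) (fun j => j != i) ljz.
have Mze : z + e *: (x - z) \in M by rewrite memvD // memvZ.
have Fze : [set x | K x /\ l i x = 1] (z + e *: (x - z)).
  split.
    apply/Kl => // j; rewrite linearD linearZ /=.
    by case: (eqVneq j i) => [->|/He//]; rewrite lxz liz scaler0 addr0.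
  by rewrite linearD linearZ /= lxz liz scaler0 addr0.
have Fz : [set x | K x /\ l i x = 1] z by [].
have := aff_hull_line e^-1 Fz Fze.
by rewrite (addrC z (e *: _)) addrK scalerA mulVf ?scale1r ?gt_eqF // addrC subrK.
Qed.

(** Each coordinate is bounded on K by the sum [B] of its absolute values at the generators; a
    nonzero coordinate of x could be scaled to [B + 1]. *)
Lemma polytope_unbounded_ray K x :
  polytope K -> (forall a : R, K (a *: x)) -> x = 0.
Proof.
case=> A /finite_seqP[ps ->] -> Kx.
pose b := vbasis (@fullv R V).
rewrite (coord_vbasis (memvf x)) big1 // => i _; apply/eqP.
rewrite scaler_eq0; apply/orP; left; apply/negPn/negP => ex0.
pose B := \sum_(p <- ps) `|coord b i p|.
have [m [p [t [Ap t0 t1 xE]]]] := Kx ((B + 1) / coord b i x).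
have := congr1 (coord b i) xE; rewrite linearZ /= divfK // linear_sum /=.
apply/eqP; rewrite gt_eqF // (@le_lt_trans _ _ B) ?ltrDl //.
rewrite -[B]mul1r -t1 mulr_suml ler_sum // => j _; rewrite linearZ /=.
rewrite ler_wpM2l // (le_trans (ler_norm _)) // /B.
have pj : p j \in ps by exact: Ap.
by rewrite (big_rem _ pj) /= lerDl sumr_ge0.
Qed.

(** The functional 0 at level 1 cuts out the empty face, of dimension -1 against 0 for the point. *)
Lemma facet_point K : K = [set 0] -> facet K set0.
Proof.
move=> ->; split.
  exists (\0 : {scalar V}), 1; split=> [x _|]; first by rewrite ler01.
  by apply/esym; rewrite -subset0 => x [_ /esym/eqP]; rewrite oner_eq0.
exists 0; split.
  rewrite (_ : 0 = (\dim (0%VS : {vspace V}))%:Z); last by rewrite dimv0.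
  apply: (@affine_dim_coset _ 0); apply/seteqP; split.
    by apply: aff_hull_sub => x -> /=; rewrite subr0 mem0v.
  move=> x /=; rewrite subr0 memv0 => /eqP ->.
  by have := @aff_hull_line [set 0] 0 0 0 erefl erefl; rewrite scale0r addr0.
exists 0%N, (fun=> 0); split=> [t _ _ []//| |]; last by rewrite sub0r.
by congr aff_hull; apply/seteqP; split=> // x [[]].
Qed.

(** In a shortest description of K inside M every inequality is irredundant, hence gives a facet.
    The maximum with 1 covers the empty description, where K is a point. *)
Lemma polytope_facets K M :
  polytope K -> K `<=` [set` M] ->
  (forall x, x \in M -> exists2 e, 0 < e & K (e *: x)) ->
  exists N (l : 'I_N -> 'Hom(V, R^o)),
    (forall x, x \in M -> K x <-> forall i, l i x <= 1) /\
    `I_(maxn 1 N) #<= facet K.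
Proof.
move=> pK KM Kabs.
pose rep N := exists l : 'I_N -> 'Hom(V, R^o),
  forall x, x \in M -> K x <-> forall i, l i x <= 1.
have [cs csP] := polytope_halfspaces pK.
have K0 : K 0 by have [e _] := Kabs 0 (mem0v _); rewrite scaler0.
have exrep : exists N, `[< rep N >].
  (* Inequalities with positive right side are normalized to 1; those with right side 0 hold on all
     of M because K absorbs M. *)
  pose cs' := [seq c <- cs | 0 < c.2].
  exists (size cs'); apply/asboolP.
  exists (fun i => (nth (0, 0) cs' i).2^-1 *: (nth (0, 0) cs' i).1) => x Mx.
  rewrite csP; split=> H.
    move=> i; have : nth (0, 0) cs' i \in cs' by exact: mem_nth.
    rewrite mem_filter => /andP[c0 /H]; rewrite lfunE /= /GRing.scale /= mulrC.
    by rewrite ler_pdivrMr // mul1r.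
  move=> c cs_c; have [c0|c0] := ltP 0 c.2.
    have cs'_c : c \in cs' by rewrite mem_filter c0.
    have := cs'_c; rewrite -index_mem => ic.
    have := H (Ordinal ic); rewrite /= nth_index // lfunE /= /GRing.scale /= mulrC.
    by rewrite ler_pdivrMr // mul1r.
  have cE : c.2 = 0.
    by apply/eqP; rewrite eq_le c0; have /csP/(_ _ cs_c) := K0; rewrite linear0.
  have [e e0 /csP/(_ _ cs_c)] := Kabs x Mx.
  by rewrite cE linearZ /= pmulr_rle0.
have [N /asboolP[l lP] minN] := ex_minnP exrep.
exists N, l; split=> //.
(* Without inequalities K is all of M, so it contains the whole line through each of its points. *)
case: N => [|N] in l lP minN *.
  have K1 : K = [set 0].
    apply/seteqP; split=> [x Kx /=|x -> //]; apply: (polytope_unbounded_ray pK) => a.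
    by apply/lP => [|[]//]; rewrite memvZ //; exact: KM.
  rewrite maxn0; apply: card_le_trans (subset_card_le (_ : [set set0] `<=` _)).
    by rewrite (card_le_eqr card_set1) card_lexx.
  by move=> F ->; exact: facet_point.
rewrite (maxn_idPr _) //.
(* Otherwise skipping i with [lift i] would leave a shorter description. *)
have irr i : exists y, [/\ y \in M, forall j, j != i -> l j y <= 1 & 1 < l i y].
  apply: contrapT => noy; suff /minN : `[< rep N >] by rewrite ltnn.
  apply/asboolP; exists (fun j => l (lift i j)) => x Mx; split=> [/lP|H].
    by move=> /(_ Mx).
  apply/lP => // j; rewrite leNgt; apply/negP => ljx.
  have ji : j = i.
    case: (unliftP i j) => // k jE; move: ljx; rewrite jE ltNge => /negP[].
    exact: H.
  apply: noy; exists x; split=> //; last by rewrite -ji.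
  move=> k; case: (unliftP i k) => [k' -> _|->]; first exact: H.
  by rewrite eqxx.
(* [F] must be defined on all of nat; the default [set0] is never reached below N.+1. *)
pose F k : set V := if insub k is Some i then [set x | K x /\ l i x = 1] else set0.
have FE (i : 'I_N.+1) : F i = [set x | K x /\ l i x = 1].
  by rewrite /F valK.
have facetF (i : 'I_N.+1) : facet K (F i) /\ exists z, [/\ K z, l i z = 1 &
    forall j, j != i -> l j z < 1].
  by have [y [My ly liy]] := irr i; rewrite FE; exact: irredundant_facet My ly liy.
apply: card_le_trans (subset_card_le (_ : F @` `I_N.+1 `<=` _)).
  rewrite (card_le_eqr (inj_card_eq _)) ?card_lexx //.
  move=> a b; rewrite !inE /= => aN bN; pose i := Ordinal aN; pose j := Ordinal bN.
  rewrite -[a]/(val i) -[b]/(val j) => Fij; congr val; apply/eqP.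
  apply/negPn/negP => ij; have [_ [z [Kz liz ljz]]] := facetF i.
  have : F i z by rewrite FE.
  rewrite Fij FE => -[_ lz]; have := ljz j; rewrite eq_sym => /(_ ij).
  by rewrite lz ltxx.
by move=> _ [k /= kN <-]; have [] := facetF (Ordinal kN).
Qed.

End Facets.

(** * Integration over the sphere *)

Section SphereExpectation.
Context {R : realType} {n : nat}.
Implicit Types f g : borel_rV R n -> R.
Local Notation S := (euclid_sphere R n).

(** The bound is asked on the sphere only, so that forms qualify; the class is closed under sums and
    products and integrable on the sphere. *)
Definition bounded_borel f :=
  measurable_fun setT f /\ exists B, forall x, S x -> `|f x| <= B.

Lemma measurable_coord i :
  measurable_fun setT ((fun x => (x : 'rV[R]_n) 0 i) : borel_rV R n -> R).
Proof.
apply: (measurability _ (RGenOInfty.measurableE R)).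
move=> _ [_ [a ->] <-]; apply: sub_sigma_algebra; rewrite setTI.
have /continuousP := @coord_continuous R 1 n 0 i.
by apply; exact: interval_open.
Qed.

Lemma bounded_borel_cst a : bounded_borel (fun=> a).
Proof. by split; [exact: measurable_cst|exists `|a|]. Qed.

Lemma bounded_borelD f g :
  bounded_borel f -> bounded_borel g -> bounded_borel (fun x => f x + g x).
Proof.
move=> [mf [B fB]] [mg [C gC]]; split; first exact: measurable_funD.
exists (B + C) => x Sx; rewrite (le_trans (ler_normD _ _)) // lerD //.
- exact: fB.
- exact: gC.
Qed.

Lemma bounded_borelM f g :
  bounded_borel f -> bounded_borel g -> bounded_borel (fun x => f x * g x).
Proof.
move=> [mf [B fB]] [mg [C gC]]; split; first exact: measurable_funM.
exists (B * C) => x Sx; rewrite normrM ler_pM //.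
- exact: fB.
- exact: gC.
Qed.

Lemma bounded_borelZ a f : bounded_borel f -> bounded_borel (fun x => a * f x).
Proof. by apply: bounded_borelM; exact: bounded_borel_cst. Qed.

Lemma bounded_borel_sum I (r : seq I) (F : I -> borel_rV R n -> R) :
  (forall i, bounded_borel (F i)) -> bounded_borel (fun x => \sum_(i <- r) F i x).
Proof.
move=> FF; elim: r => [|i r IH].
  by under eq_fun do rewrite big_nil; exact: bounded_borel_cst.
by under eq_fun do rewrite big_cons; exact: bounded_borelD.
Qed.

Lemma bounded_borel_prod I (r : seq I) (F : I -> borel_rV R n -> R) :
  (forall i, bounded_borel (F i)) -> bounded_borel (fun x => \prod_(i <- r) F i x).
Proof.
move=> FF; elim: r => [|i r IH].
  by under eq_fun do rewrite big_nil; exact: bounded_borel_cst.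
by under eq_fun do rewrite big_cons; exact: bounded_borelM.
Qed.

Lemma bounded_borelX f m : bounded_borel f -> bounded_borel (fun x => f x ^+ m).
Proof.
move=> ff; elim: m => [|m IH].
  by under eq_fun do rewrite expr0; exact: bounded_borel_cst.
by under eq_fun do rewrite exprS; exact: bounded_borelM.
Qed.

Lemma sphere_coord_le1 x i : S x -> `|x 0 i| <= 1.
Proof.
move=> Sx; rewrite -(@expr_le1 _ 2) // real_normK ?num_real // -Sx (bigD1 i) //=.
by rewrite lerDl sumr_ge0 // => j _; rewrite sqr_ge0.
Qed.

Lemma bounded_borel_coord i : bounded_borel (fun x => x 0 i).
Proof.
by split; [exact: measurable_coord|exists 1 => x; exact: sphere_coord_le1].
Qed.

Lemma bounded_borel_dot (y : 'rV[R]_n) : bounded_borel (fun x => \sum_i x 0 i * y 0 i).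
Proof.
apply: bounded_borel_sum => i; apply: bounded_borelM.
- exact: bounded_borel_coord.
- exact: bounded_borel_cst.
Qed.

Lemma bounded_borel_form d (f : hform R n d) : bounded_borel (hform_eval f).
Proof.
rewrite /hform_eval; under eq_fun do rewrite mevalE.
apply: bounded_borel_sum => m; apply: bounded_borelZ.
by apply: bounded_borel_prod => i; apply: bounded_borelX; exact: bounded_borel_coord.
Qed.

Lemma measurable_sphere : measurable S.
Proof.
have [mf _] : bounded_borel (fun x => \sum_i x 0 i ^+ 2).
  by apply: bounded_borel_sum => i; apply: bounded_borelX; exact: bounded_borel_coord.
have := mf measurableT [set 1] (measurable_set1 1); rewrite setTI.
by [].
Qed.

Context (sigma : {measure set (borel_rV R n) -> \bar R}).
Context (sigma_unif : uniform_on_sphere sigma).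

Definition expect f : R := \int[sigma]_(x in S) f x.
Local Notation E := expect.

Lemma bounded_borel_integrable f :
  bounded_borel f -> sigma.-integrable S (EFin \o f).
Proof.
move=> [mf [B fB]]; apply: measurable_bounded_integrable.
- exact: measurable_sphere.
- by case: sigma_unif => -> _ _; rewrite ltry.
- exact: measurable_funS mf.
- by exists B; split; [exact: num_real|move=> x Bx y Sy; exact: le_trans (fB y Sy) (ltW Bx)].
Qed.

Lemma expect_cst a : E (fun=> a) = a.
Proof.
rewrite /expect Rintegral_cst; last exact: measurable_sphere.
by case: sigma_unif => -> _ _; rewrite mulr1.
Qed.

Lemma expectD f g : bounded_borel f -> bounded_borel g ->
  E (fun x => f x + g x) = E f + E g.
Proof.
by move=> ff fg; rewrite /expect RintegralD //;
  [exact: measurable_sphere|exact: bounded_borel_integrable..].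
Qed.

Lemma expectZ a f : bounded_borel f -> E (fun x => a * f x) = a * E f.
Proof.
by move=> ff; rewrite /expect RintegralZl //;
  [exact: measurable_sphere|exact: bounded_borel_integrable].
Qed.

Lemma expect_sum I (r : seq I) (F : I -> borel_rV R n -> R) :
  (forall i, bounded_borel (F i)) ->
  E (fun x => \sum_(i <- r) F i x) = \sum_(i <- r) E (F i).
Proof.
move=> FF; elim: r => [|i r IH].
  by rewrite big_nil; under eq_fun do rewrite big_nil; exact: expect_cst.
rewrite big_cons -IH -expectD //; last exact: bounded_borel_sum.
by congr E; apply/funext => x; rewrite big_cons.
Qed.

Lemma le_expect f g : bounded_borel f -> bounded_borel g ->
  (forall x, S x -> f x <= g x) -> E f <= E g.
Proof.
by move=> ff fg fg_le; apply: le_Rintegral => //;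
  [exact: measurable_sphere|exact: bounded_borel_integrable..].
Qed.

Lemma eq_expect f g : (forall x, S x -> f x = g x) -> E f = E g.
Proof. by move=> fg; apply: eq_Rintegral => x; rewrite inE => /fg. Qed.

Lemma integral_expect f : bounded_borel f ->
  (\int[sigma]_(x in S) (f x)%:E)%E = (E f)%:E.
Proof.
move=> ff; rewrite /expect /Rintegral fineK //; apply: integrable_fin_num => //.
- exact: measurable_sphere.
- exact: bounded_borel_integrable.
Qed.

Lemma sphere_mulmx (Q : 'M[R]_n) (x : 'rV[R]_n) : Q *m Q^T = 1%:M ->
  S (x *m Q) = S x.
Proof.
have dotE (y : 'rV[R]_n) : \sum_i y 0 i ^+ 2 = (y *m y^T) 0 0.
  by rewrite mxE; apply: eq_bigr => i _; rewrite mxE expr2.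
move=> QQ; rewrite /euclid_sphere /= !dotE trmx_mul mulmxA -(mulmxA x) QQ.
by rewrite mulmx1.
Qed.

Lemma continuous_mulmx (Q : 'M[R]_n) : continuous (fun x : 'rV[R]_n => x *m Q).
Proof.
move=> x A /nbhs_ballP[e /= e0 eA].
(* [C] exceeds every column sum of |Q|, so in the sup norm a ball of radius e / C is mapped into one
   of radius e. *)
pose C := 1 + \sum_i \sum_j `|Q i j|.
have C0 : 0 < C.
  by rewrite ltr_wpDr // sumr_ge0 // => i _; rewrite sumr_ge0.
apply/nbhs_ballP; exists (e / C); first by rewrite /= divr_gt0.
move=> y [_ xy]; apply: eA; split=> // i j; rewrite ord1.
rewrite /ball /= !mxE -sumrB.
apply: le_lt_trans (ler_norm_sum _ _ _) _.
apply: (@le_lt_trans _ _ (\sum_k e / C * `|Q k j|)).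
  apply: ler_sum => k _; rewrite -mulrBl normrM ler_wpM2r //.
  exact: ltW (xy 0 k).
rewrite -mulr_sumr mulrAC ltr_pdivrMr // ltr_pM2l // /C ltr_pwDl //.
apply: ler_sum => k _; rewrite (bigD1 j) //= lerDl.
by rewrite sumr_ge0.
Qed.

Lemma measurable_mulmx (Q : 'M[R]_n) :
  measurable_fun setT ((fun x => (x : 'rV[R]_n) *m Q) : borel_rV R n -> borel_rV R n).
Proof.
have borelE : @measurable _ (borel_rV R n) = <<s @open 'rV[R]_n >> by [].
apply: (@measurability _ _ (borel_rV R n) (borel_rV R n) setT
  (fun x : borel_rV R n => (x : 'rV_n) *m Q) _ borelE) => _ [A oA <-].
apply: sub_sigma_algebra.
rewrite setTI; exact: (continuousP _).1 (@continuous_mulmx Q) A oA.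
Qed.

(** Change of variables: [sigma] is its own image under x |-> x Q, and this map preserves the
    sphere. *)
Lemma expect_orthogonal (Q : 'M[R]_n) f : Q *m Q^T = 1%:M -> bounded_borel f ->
  E (fun x => f ((x : 'rV[R]_n) *m Q)) = E f.
Proof.
move=> QQ ff; have [_ _ inv] := sigma_unif.
pose phi : borel_rV R n -> borel_rV R n := fun x => (x : 'rV[R]_n) *m Q.
have mphi : measurable_fun setT phi by exact: measurable_mulmx.
have preS : phi @^-1` S = S by apply/seteqP; split=> x /=; rewrite sphere_mulmx.
have [mf fB] := ff.
have ffphi : bounded_borel (f \o phi).
  split; first exact: measurableT_comp.
  by case: fB => B fB; exists B => x Sx; apply: fB; rewrite sphere_mulmx.
rewrite /expect /Rintegral; congr fine.
have := @integral_pushforward _ _ _ _ R phi mphi sigma S (EFin \o f).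
rewrite preS => H.
have /= <- := H _ _ measurable_sphere.
- apply: eq_measure_integral => A mA _; exact: inv.
- exact/measurable_EFinP.
- exact: bounded_borel_integrable.
Qed.

End SphereExpectation.

(** * Moments of linear forms *)

(** The difference vanishes at as many distinct naturals as its size. *)
Lemma eq_horner_poly (R : numDomainType) (p q : {poly R}) :
  (forall b, p.[b] = q.[b]) -> p = q.
Proof.
move=> pq; apply/eqP; rewrite -subr_eq0; apply/eqP.
apply: (@roots_geq_poly_eq0 _ _ [seq i%:R | i <- iota 0 (size (p - q))]).
- by apply/allP => _ /mapP[i _ ->]; rewrite /root !hornerE pq subrr.
- by rewrite map_inj_uniq ?iota_uniq // => i j /eqP; rewrite eqr_nat => /eqP.
- by rewrite size_map size_iota.
Qed.

Section Moments.
Context {R : realType} {n : nat}.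
Context {sigma : {measure set (borel_rV R n.+1) -> \bar R}}.
Context (sigma_unif : uniform_on_sphere sigma).
Local Notation S := (euclid_sphere R n.+1).
Local Notation E := (expect sigma).

(* Q is the Householder reflection exchanging x and the first basis vector. *)
Lemma reflection_to_coord (x : 'rV[R]_n.+1) : S x ->
  exists Q : 'M[R]_n.+1, Q *m Q^T = 1%:M /\
    forall v : 'rV[R]_n.+1, (v *m Q) 0 0 = \sum_i v 0 i * x 0 i.
Proof.
move=> Sx; pose u : 'rV[R]_n.+1 := x - delta_mx 0 0.
have xx : x *m x^T = 1%:M.
  apply/matrixP => i j; rewrite !ord1 !mxE -[RHS]Sx.
  by apply: eq_bigr => k _; rewrite mxE expr2.
have dot (v w : 'rV[R]_n.+1) : v *m w^T = (\sum_i v 0 i * w 0 i)%:M.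
  apply/matrixP => i j; rewrite !ord1 !mxE mulr1n.
  by apply: eq_bigr => k _; rewrite mxE.
have dote (v : 'rV[R]_n.+1) : v *m (delta_mx 0 0 : 'rV[R]_n.+1)^T = (v 0 0)%:M.
  by rewrite trmx_delta -colE; apply/matrixP => i j; rewrite !ord1 !mxE mulr1n.
have uu : u *m u^T = (2 * (1 - x 0 0))%:M.
  rewrite /u linearB /= mulmxBl !mulmxBr !dote xx -[delta_mx 0 0 *m x^T]trmxK.
  rewrite trmx_mul trmxK dote tr_scalar_mx mxE !eqxx.
  by rewrite -!raddfB /=; congr (_%:M); ring.
(* If x is already the first basis vector, u = 0 and the identity replaces the reflection. *)
have [x1|x1] := eqVneq (x 0 0) 1.
  have u0 : u = 0.
    have : \sum_i u 0 i ^+ 2 = 0.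
      have := congr1 (@mxtrace R 1) uu.
      rewrite x1 subrr mulr0 dot !mxtrace_scalar !mulr1n => H; rewrite -[RHS]H.
      by apply: eq_bigr => i _; rewrite expr2.
    move=> /psumr_eq0P u0; apply/rowP => i; rewrite [RHS]mxE; apply/eqP.
    by rewrite -sqrf_eq0 u0 // => j _; exact: sqr_ge0.
  exists 1%:M; split=> [|v]; first by rewrite trmx1 mulmx1.
  rewrite mulmx1 (subr0_eq u0).
  rewrite -[LHS]mulr1n -[RHS]mulr1n -!(@mxtrace_scalar _ 1) -dote; congr mxtrace.
  by rewrite dot.
have s0 : 1 - x 0 0 != 0 by rewrite subr_eq0 eq_sym.
have vu (v : 'rV[R]_n.+1) : v *m u^T = (\sum_i v 0 i * x 0 i - v 0 0)%:M.
  by rewrite /u linearB /= mulmxBr dote dot raddfB.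
have u00 : u 0 0 = x 0 0 - 1 by rewrite !mxE.
(* Here |u|^2 = 2 (1 - x_0), so k = 2 / |u|^2 and 1 - k A is the reflection along u. *)
clearbody u; pose A := u^T *m u; pose k := (1 - x 0 0)^-1.
have AA : k ^+ 2 *: (A *m A) = (k *+ 2) *: A.
  rewrite /A mulmxA -(mulmxA _ u) uu -mulmxA mul_scalar_mx -scalemxAr scalerA.
  by congr (_ *: _); rewrite /k; field.
have AT : A^T = A by rewrite /A trmx_mul trmxK.
have QT : (1%:M - k *: A)^T = 1%:M - k *: A.
  by rewrite linearB /= linearZ /= trmx1 AT.
exists (1%:M - k *: A); split.
  rewrite QT mulmxBl mul1mx mulmxBr mulmx1.
  rewrite -scalemxAl -scalemxAr scalerA -expr2 AA mulr2n scalerDl.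
  by rewrite opprB addrK subrK.
move=> v; rewrite mulmxBr mulmx1 -scalemxAr mulmxA vu mul_scalar_mx.
by rewrite !mxE u00 /k; field.
Qed.

(** The gamma_m of the overview. *)
Definition coord_moment m := E (fun v => v 0 0 ^+ (2 * m)).

Lemma expect_dotX (x : 'rV[R]_n.+1) m : S x ->
  E (fun v => (\sum_i v 0 i * x 0 i) ^+ (2 * m)) = coord_moment m.
Proof.
move=> Sx; have [Q [QQ Qx]] := reflection_to_coord Sx.
rewrite /coord_moment -(expect_orthogonal sigma_unif QQ (f := fun v => v 0 0 ^+ (2 * m))).
  by apply: eq_expect => v _; rewrite Qx.
by apply: bounded_borelX; exact: bounded_borel_coord.
Qed.

Lemma expect_dotX_norm (y : 'rV[R]_n.+1) m : 0 < \sum_i y 0 i ^+ 2 ->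
  E (fun v => (\sum_i v 0 i * y 0 i) ^+ (2 * m)) =
  coord_moment m * (\sum_i y 0 i ^+ 2) ^+ m.
Proof.
set N := \sum_i _ => N0; pose t := Num.sqrt N.
have t0 : t != 0 by rewrite gt_eqF // sqrtr_gt0.
have t2 : t ^+ 2 = N by rewrite sqr_sqrtr // ltW.
have Sx : S (t^-1 *: y).
  rewrite /euclid_sphere /=; under eq_bigr do rewrite mxE exprMn.
  by rewrite -mulr_sumr exprVn t2 mulVf // gt_eqF.
rewrite -(expect_dotX m Sx) -t2 -exprM mulrC -(expectZ sigma_unif); last first.
  by apply: bounded_borelX; exact: bounded_borel_dot.
apply: eq_expect => v _; rewrite -exprMn mulr_sumr; congr (_ ^+ _).
by apply: eq_bigr => i _; rewrite mxE mulrCA mulVKf.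
Qed.

Lemma coord_moment0 : coord_moment 0 = 1.
Proof.
by rewrite /coord_moment (_ : (fun _ => _) = fun=> 1) ?expect_cst //; exact/funext.
Qed.

Lemma bounded_borel_coord2 i j a b :
  bounded_borel (fun v : borel_rV R n.+1 => v 0 i ^+ a * v 0 j ^+ b).
Proof.
by apply: bounded_borelM; apply: bounded_borelX; exact: bounded_borel_coord.
Qed.

(* Both sides of E (v_0 + b v_j)^(2m+2) = gamma_(m+1) (1 + b^2)^(m+1) are
   polynomials in b; compare the coefficients of b^2. *)
Lemma mixed_moment m (j : 'I_n.+1) : j != 0 ->
  (2 * m).+1%:R * E (fun v => v 0 0 ^+ (2 * m) * v 0 j ^+ 2) = coord_moment m.+1.
Proof.
move=> j0; pose c i := E (fun v => v 0 0 ^+ (2 * m.+1 - i) * v 0 j ^+ i) *+ 'C(2 * m.+1, i).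
have pq : \poly_(i < (2 * m.+1).+1) c i = coord_moment m.+1 *: (1 + 'X^2) ^+ m.+1.
  apply: eq_horner_poly => b; rewrite horner_poly.
  pose y : 'rV[R]_n.+1 := delta_mx 0 0 + b *: delta_mx 0 j.
  have y0 : y 0 0 = 1 by rewrite !mxE !eqxx eq_sym (negPf j0) mulr0 addr0.
  have yj : y 0 j = b by rewrite !mxE !eqxx (negPf j0) mulr1 add0r.
  have yi i : i != 0 -> i != j -> y 0 i = 0.
    by move=> i0 ij; rewrite !mxE !eqxx (negPf i0) (negPf ij) mulr0 addr0.
  have sum2 (F : 'I_n.+1 -> R) : (forall i, i != 0 -> i != j -> F i = 0) ->
      \sum_i F i = F 0 + F j.
    move=> F0; rewrite (bigD1 0) //= (bigD1 j) //= big1 ?addr0 //.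
    by move=> i /andP[]; exact: F0.
  have yy : \sum_i y 0 i ^+ 2 = 1 + b ^+ 2.
    rewrite sum2 ?y0 ?yj ?expr1n // => i i0 ij; by rewrite yi // expr0n.
  have := expect_dotX_norm (y := y) m.+1.
  rewrite yy ltr_pwDl ?sqr_ge0 // => /(_ isT) H.
  rewrite hornerZ horner_exp !hornerE -H.
  have -> : (fun v : 'rV[R]_n.+1 => (\sum_i v 0 i * y 0 i) ^+ (2 * m.+1)) =
      (fun v => \sum_(i < (2 * m.+1).+1)
        ('C(2 * m.+1, i)%:R * b ^+ i) * (v 0 0 ^+ (2 * m.+1 - i) * v 0 j ^+ i)).
    apply/funext => v; rewrite sum2; last by move=> i i0 ij; rewrite yi ?mulr0.
    rewrite y0 yj mulr1 exprDn; apply: eq_bigr => i _.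
    by rewrite exprMn -mulr_natl; ring.
  rewrite (expect_sum sigma_unif) => [|i]; last first.
    by apply: bounded_borelZ; exact: bounded_borel_coord2.
  apply: eq_bigr => i _; rewrite (expectZ sigma_unif); last exact: bounded_borel_coord2.
  by rewrite /c -mulr_natl; ring.
have := congr1 (fun p : {poly R} => p`_2) pq.
rewrite coef_poly coefZ exprDn coef_sum.
rewrite (bigD1 (Ordinal (isT : (1 < m.+2)%N))) //= big1 => [|i]; last first.
  rewrite -val_eqE /= => i1.
  rewrite expr1n mul1r -exprM coefMn coefXn.
  by rewrite (_ : (2 == 2 * i)%N = false) ?mul0rn //; apply/negbTE/eqP; lia.
rewrite expr1n mul1r -exprM coefMn coefXn bin1 addr0 mulnS /= /c.
rewrite (_ : 2 * m.+1 = (2 * m).+2)%N ?mulnS // !subSS subn0.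
(* The factor m + 1 cancels against the coefficient of b^2 in (1 + b^2)^(m+1). *)
have -> : 'C((2 * m).+2, 2) = (m.+1 * (2 * m).+1)%N.
  by have := mul_bin_diag (2 * m).+2 1; rewrite /= bin1; nia.
set e := E _ => H; apply: (@mulfI _ m.+1%:R); first by rewrite pnatr_eq0.
by rewrite mulrA -natrM mulr_natl H mulrC.
Qed.

(** Insert 1 = sum of the v_j^2 into gamma_m: the term j = 0 is gamma_(m+1), and each of the n
    others is gamma_(m+1) / (2m+1) by [mixed_moment]. *)
Lemma coord_momentS m :
  (2 * m).+1%:R * coord_moment m = (2 * m + n.+1)%:R * coord_moment m.+1.
Proof.
have -> : coord_moment m = E (fun v => \sum_j v 0 0 ^+ (2 * m) * v 0 j ^+ 2).
  by apply: eq_expect => v Sv; rewrite -mulr_sumr Sv mulr1.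
rewrite (expect_sum sigma_unif) => [|j]; last exact: bounded_borel_coord2.
rewrite big_ord_recl mulrDr mulr_sumr.
under [X in _ + X]eq_bigr => j _ do rewrite mixed_moment //.
rewrite sumr_const card_ord -[X in _ + X]mulr_natl.
have -> : E (fun v => v 0 ord0 ^+ (2 * m) * v 0 ord0 ^+ 2) = coord_moment m.+1.
  by apply: eq_expect => v _; rewrite -exprD mulnS addnC.
by rewrite -mulrDl -natrD addSn addnS.
Qed.

Lemma coord_moment_gt0 m : 0 < coord_moment m.
Proof.
elim: m => [|m IH]; first by rewrite coord_moment0.
by rewrite -(pmulr_rgt0 _ (_ : 0 < (2 * m + n.+1)%:R)) -?coord_momentS ?mulr_gt0 // ltr0n addnS.
Qed.

(** For k < m the ratio gamma_(k+1) / gamma_k = (2k+1) / (2k+n+1) is at most 2m / (n+1); the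
    induction runs over k with this base fixed. *)
Lemma coord_moment_le m : coord_moment m <= ((2 * m)%:R / n.+1%:R) ^+ m.
Proof.
suff H k : (k <= m)%N -> coord_moment k <= ((2 * m)%:R / n.+1%:R) ^+ k by exact: H.
elim: k => [|k IH] km; first by rewrite coord_moment0.
have n0 : 0 < n.+1%:R :> R by rewrite ltr0n.
have := coord_moment_gt0 k; have := coord_moment_gt0 k.+1 => g1 g0.
have : n.+1%:R * coord_moment k.+1 <= (2 * m)%:R * coord_moment k.
  apply: (@le_trans _ _ ((2 * k + n.+1)%:R * coord_moment k.+1)).
    by rewrite ler_pM2r // ler_nat leq_addl.
  by rewrite -coord_momentS ler_pM2r // ler_nat; lia.
rewrite -ler_pdivlMl // mulrA [_^-1 * _]mulrC => /le_trans; apply.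
by rewrite exprS ler_wpM2l ?divr_ge0 // IH // ltnW.
Qed.

End Moments.

(** * Nonnegative forms *)

HB.instance Definition _ (R : realType) (n d : nat) := Vector.on (hform R n.+1 d).

Lemma linear_lfun (R : realType) (V : vectType R) (f : V -> R) :
  linear_for *%R f -> exists L : 'Hom(V, R^o), forall x, L x = f x.
Proof.
move=> lin; pose F : {linear V -> R^o} :=
  HB.pack (f : V -> R^o) (GRing.isLinear.Build R V R^o _ (f : V -> R^o) lin).
by exists (linfun F) => x; rewrite lfunE.
Qed.

(** Induction step: multiply the hypothesis by b and add (k+1) a^k (a-b)^2 >= 0. *)
Lemma weighted_amgm (R : realDomainType) (a b : R) k : 0 <= a -> 0 <= b ->
  k.+1%:R * (a ^+ k * b) <= k%:R * a ^+ k.+1 + b ^+ k.+1.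
Proof.
move=> a0 b0; elim: k => [|k IH]; first by rewrite !expr0 mul0r add0r !mul1r.
have := ler_wpM2r b0 IH.
have : 0 <= k.+1%:R * (a ^+ k * (a - b) ^+ 2).
  by apply: mulr_ge0 => //; apply: mulr_ge0; [exact: exprn_ge0|exact: sqr_ge0].
rewrite -subr_ge0 => h1; rewrite -subr_ge0 => h2.
rewrite -subr_ge0; apply: le_trans (addr_ge0 h1 h2) _.
rewrite le_eqVlt; apply/orP; left; apply/eqP.
by rewrite !exprS -!natr1; ring.
Qed.

(** * Powers of linear forms *)

Section PowersOfLinearForms.
Context {R : realType} {n k : nat}.
Implicit Types (phi : {ffun 'I_k -> 'I_n}) (v x : 'rV[R]_n).

Lemma monomial_homog phi :
  (\prod_j 'X_(phi j) : {mpoly R[n]}) \is k.-homog.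
Proof.
suff H (s : seq 'I_k) :
    (\prod_(j <- s) 'X_(phi j) : {mpoly R[n]}) \is (size s).-homog.
  by have := H (enum 'I_k); rewrite -cardE card_ord big_enum.
elim: s => [|j s IH]; first by rewrite big_nil dhomog1.
by rewrite big_cons -[size _]/(1 + size s)%N dhomogM // dhomogX /= mdeg1.
Qed.

Definition monomial phi : hform R n k := DHomog (monomial_homog phi).

(** Takes the point first, so that evaluation at x can be declared linear. *)
Definition eval_at x (f : hform R n k) : R := hform_eval f x.

Lemma eval_at_linear x : linear_for *%R (eval_at x).
Proof. by move=> a f g; rewrite /eval_at /hform_eval /= mevalD mevalZ. Qed.

HB.instance Definition _ x :=
  GRing.isLinear.Build R (hform R n k) R *%R (eval_at x) (eval_at_linear x).

Lemma hform_eval_monomial phi x :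
  hform_eval (monomial phi) x = \prod_j x 0 (phi j).
Proof.
by rewrite /hform_eval /= rmorph_prod /=; apply: eq_bigr => j _; rewrite mevalXU.
Qed.

(** This is (v . x)^k, fully expanded so that every linear functional of it is visibly a polynomial
    in v. *)
Definition dot_pow v : hform R n k :=
  \sum_(phi : {ffun 'I_k -> 'I_n}) (\prod_j v 0 (phi j)) *: monomial phi.

Lemma hform_eval_sum I (r : seq I) (P : pred I) (a : I -> R) (F : I -> hform R n k) x :
  hform_eval (\sum_(i <- r | P i) a i *: F i) x =
  \sum_(i <- r | P i) a i * hform_eval (F i) x.
Proof.
rewrite -/(eval_at x _) linear_sum /=.
by apply: eq_bigr => i _; rewrite linearZ.
Qed.

Lemma hform_eval_dot_pow v x :
  hform_eval (dot_pow v) x = (\sum_i v 0 i * x 0 i) ^+ k.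
Proof.
rewrite hform_eval_sum.
under eq_bigr do rewrite hform_eval_monomial -big_split /=.
rewrite -(bigA_distr_bigA (fun _ i => v 0 i * x 0 i)) /=.
by rewrite prodr_const card_ord.
Qed.

End PowersOfLinearForms.
Arguments monomial R {n k} phi.
Arguments dot_pow {R n} k v.

(** * The bound on the number of facets, with a free exponent *)

Section Sandwich.
Context {R : realType} {n d : nat}.
Context {sigma : {measure set (borel_rV R n.+1) -> \bar R}}.
Context (sigma_unif : uniform_on_sphere sigma).
Local Notation S := (euclid_sphere R n.+1).
Local Notation E := (expect sigma).
Local Notation V := (hform R n.+1 (2 * d)).
Local Notation r := (sumsq_pow R n.+1 d).
Local Notation Pos := (Pos_hform R n.+1 d).

Lemma hform_eval_sumsq x : S x -> hform_eval r x = 1.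
Proof.
move=> Sx; rewrite /hform_eval /= rmorphXn raddf_sum /=.
under eq_bigr do rewrite rmorphXn /= mevalXU.
by rewrite Sx expr1n.
Qed.

Lemma Pos_dot_pow v : Pos (dot_pow (2 * d)%N v).
Proof.
by move=> x Sx; rewrite hform_eval_dot_pow exprM exprn_ge0 // sqr_ge0.
Qed.

Lemma bounded_borel_form_moment (L : 'Hom(V, R^o)) :
  bounded_borel (fun v : borel_rV R n.+1 => L (dot_pow (2 * d)%N v)).
Proof.
under eq_fun do rewrite linear_sum /=.
apply: bounded_borel_sum => phi; under eq_fun do rewrite linearZ /=.
apply: bounded_borelM; last exact: bounded_borel_cst.
by apply: bounded_borel_prod => j; exact: bounded_borel_coord.
Qed.

(* L behaves like integration against a probability measure on the sphere, so
   this is Jensen's inequality for L followed by E (v . x)^(2dk) = gamma_(dk).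
   Jensen is replaced by weighted AM-GM inside E, tested against L through
   the form x |-> E (G^(k-1) (v . x)^(2d)). *)
Lemma expect_form_moment (L : 'Hom(V, R^o)) k :
  (forall f, Pos f -> 0 <= L f) -> L r = 1 ->
  E (fun v => (L (dot_pow (2 * d)%N v) : R) ^+ k.+1) <= coord_moment (sigma := sigma) (d * k.+1).
Proof.
move=> Lpos Lr; pose G (v : borel_rV R n.+1) := L (dot_pow (2 * d)%N v) : R.
have bG : bounded_borel G by exact: bounded_borel_form_moment.
have G0 v : 0 <= G v by apply/Lpos/Pos_dot_pow.
pose w (phi : {ffun 'I_(2 * d) -> 'I_n.+1}) (v : borel_rV R n.+1) : R :=
  G v ^+ k * \prod_j v 0 (phi j).
have bw phi : bounded_borel (w phi).
  apply: bounded_borelM; first exact: bounded_borelX.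
  by apply: bounded_borel_prod => j; exact: bounded_borel_coord.
(* The mean over v of G^k q_v, taken coefficient by coefficient so that [L] passes inside. *)
pose F : V := \sum_phi E (w phi) *: monomial R phi.
have LF : L F = E (fun v => G v ^+ k.+1).
  rewrite linear_sum /= (_ : (fun v => _) =
      (fun v => \sum_phi (L (monomial R phi) : R) * w phi v)).
    rewrite (expect_sum sigma_unif) => [|phi]; last exact: bounded_borelZ.
    apply: eq_bigr => phi _; rewrite linearZ /= (expectZ sigma_unif) //.
    by rewrite /GRing.scale /= mulrC.
  apply/funext => v; rewrite exprSr {2}/G linear_sum mulr_sumr.
  by apply: eq_bigr => phi _; rewrite linearZ /w /= /GRing.scale /=; ring.
set I := E _; set g := coord_moment _.
(* AM-GM with a = G v and b = (v . x)^(2d), averaged over v. *)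
have Fle x : S x -> hform_eval F x <= (k%:R * I + g) / k.+1%:R.
  move=> Sx; rewrite hform_eval_sum.
  have -> : \sum_phi E (w phi) * hform_eval (monomial R phi) x =
      E (fun v => G v ^+ k * (\sum_i v 0 i * x 0 i) ^+ (2 * d)).
    rewrite (_ : (fun v => _) =
        (fun v => \sum_phi hform_eval (monomial R phi) x * w phi v)).
      rewrite (expect_sum sigma_unif) => [|phi]; last exact: bounded_borelZ.
      by apply: eq_bigr => phi _; rewrite (expectZ sigma_unif) // mulrC.
    apply/funext => v; rewrite -hform_eval_dot_pow hform_eval_sum mulr_sumr.
    by apply: eq_bigr => phi _; rewrite /w; ring.
  rewrite ler_pdivlMr ?ltr0n // mulrC /I /g.
  have bD : bounded_borel (fun v : borel_rV R n.+1 => \sum_i v 0 i * x 0 i).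
    exact: bounded_borel_dot.
  rewrite -(expect_dotX sigma_unif _ Sx) -!(expectZ sigma_unif); first last.
  - exact: bounded_borelX.
  - by apply: bounded_borelM; exact: bounded_borelX.
  rewrite -(expectD sigma_unif); first last.
  - exact: bounded_borelX.
  - by apply: bounded_borelZ; exact: bounded_borelX.
  apply: (le_expect sigma_unif).
  - by apply: bounded_borelZ; apply: bounded_borelM; exact: bounded_borelX.
  - apply: bounded_borelD; last exact: bounded_borelX.
    by apply: bounded_borelZ; exact: bounded_borelX.
  move=> v _; rewrite mulnA [X in _ <= _ + X]exprM; apply: weighted_amgm => //.
  by rewrite exprM exprn_ge0 // sqr_ge0.
(* As L F = I and L r = 1, this yields I <= (k I + g) / (k+1), that is I <= g. *)
have : 0 <= L (((k%:R * I + g) / k.+1%:R) *: r - F).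
  apply: Lpos => x Sx; rewrite -/(eval_at x _) linearB linearZ /= /eval_at.
  by rewrite hform_eval_sumsq // mulr1 subr_ge0 Fle.
rewrite linearB linearZ /= Lr LF -/I /GRing.scale /= mulr1 subr_ge0.
rewrite ler_pdivlMr ?ltr0n // mulrSr mulrDr mulr1 mulrC.
by rewrite lerD2l.
Qed.

Context {c : R} {K : set V} (c1 : 1 < c) (d_gt0 : (0 < d)%N).
Context (K_polytope : polytope K).
Context (K_sup : translate (Pos1_hform n.+1 d sigma) r `<=` K).
Context (K_sub : K `<=` dilate (c ^+ d) (translate (Pos1_hform n.+1 d sigma) r)).

Lemma mean_form : exists mu : 'Hom(V, R^o), forall f, mu f = E (hform_eval f).
Proof.
apply: linear_lfun => a f g.
rewrite -(expectZ sigma_unif); last exact: bounded_borel_form.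
rewrite -(expectD sigma_unif); first last.
- exact: bounded_borel_form.
- by apply: bounded_borelZ; exact: bounded_borel_form.
by apply: eq_expect => x _; rewrite -!/(eval_at x _) linearP.
Qed.

(** The exponent stays free, to be chosen in the theorem; gamma_d < c^(-d) makes the denominator of
    the form [h] positive. *)
Lemma sandwich_facets : exists N,
  `I_(maxn 1 N) #<= facet K /\
  forall k, coord_moment (sigma := sigma) d < (c ^+ d)^-1 ->
    (c ^+ d)^-1 ^+ k.+1 <= N%:R * coord_moment (sigma := sigma) (d * k.+1).
Proof.
have [mu muE] := mean_form; pose M := lker mu.
have c0 : 0 < c ^+ d by rewrite exprn_gt0 // (lt_trans ltr01).
have Pos1E f : Pos1_hform n.+1 d sigma f <-> Pos f /\ mu f = 1.
  rewrite /Pos1_hform /= (integral_expect sigma_unif) -?muE; last exact: bounded_borel_form.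
  by split=> -[Pf]; [move=> [->]|move=> ->].
have mur : mu r = 1.
  by rewrite muE -(expect_cst sigma_unif 1); apply: eq_expect => x /hform_eval_sumsq.
have KM : K `<=` [set` M].
  move=> _ /K_sub[_ [g /Pos1E[_ mug] <-] <-] /=.
  by rewrite memv_ker linearZ linearB /= mug mur subrr scaler0.
have Kge x v : K x -> S v -> - c ^+ d <= hform_eval x v.
  move=> /K_sub[_ [g /Pos1E[Pg _] <-] <-] Sv.
  rewrite -/(eval_at v _) linearZ linearB /= /eval_at hform_eval_sumsq //.
  rewrite mulrBr mulr1 -[X in X <= _]add0r lerD2r mulr_ge0 ?(ltW c0) //.
  exact: Pg.
(* A small multiple of x added to [r] stays nonnegative on the sphere, where x is bounded. *)
have Kabs x : x \in M -> exists2 e, 0 < e & K (e *: x).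
  rewrite memv_ker => /eqP mux; have [_ [B xB]] := bounded_borel_form x.
  have B0 : 0 < 1 + `|B| by rewrite ltr_pwDl.
  exists (1 + `|B|)^-1; first by rewrite invr_gt0.
  apply: K_sup; exists (r + (1 + `|B|)^-1 *: x); last by rewrite addrC addKr.
  apply/Pos1E; split; last by rewrite linearD linearZ /= mur mux scaler0 addr0.
  move=> v Sv; rewrite -/(eval_at v _) linearD linearZ /= /eval_at hform_eval_sumsq //.
  rewrite -lerBlDl sub0r mulrC ler_pdivlMr // mulN1r lerNl.
  have := xB v Sv; rewrite ler_norml => /andP[+ _].
  have := ler_norm B; lra.
have [N [l [Kl Nfacet]]] := polytope_facets K_polytope KM Kabs.
exists N; split=> // k gd; rewrite leNgt; apply/negP => Nlt.
(* The mean of f may vanish, so f + e r is normalized instead and e tends to 0. *)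
have lpos i f : Pos f -> l i (f - mu f *: r) <= mu f :> R.
  move=> Pf; apply/ler_addgt0Pr => e e0.
  pose g := f + e *: r.
  have mu0 : 0 <= mu f :> R.
    rewrite muE -(expect_cst sigma_unif 0); apply: (le_expect sigma_unif) => //.
    - exact: bounded_borel_cst.
    - exact: bounded_borel_form.
  have mug : mu g = mu f + e :> R.
    by rewrite linearD linearZ /= mur /GRing.scale /= mulr1.
  have mug0 : 0 < mu g :> R by rewrite mug ltr_wpDl.
  have Kg : K ((mu g : R)^-1 *: g - r).
    apply: K_sup; exists ((mu g : R)^-1 *: g) => //; apply/Pos1E; split.
      move=> v Sv; rewrite -/(eval_at v _) linearZ /=.
      apply: mulr_ge0; first by rewrite invr_ge0 ltW.
      rewrite /g linearD linearZ /= /eval_at hform_eval_sumsq // mulr1.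
      by apply: addr_ge0; [exact: Pf|exact: ltW].
    by rewrite linearZ /= /GRing.scale /= mulVf // gt_eqF.
  have := (Kl _ (KM _ Kg)).1 Kg i.
  have -> : (mu g : R)^-1 *: g - r = (mu g : R)^-1 *: (f - (mu f : R) *: r).
    rewrite -[r in LHS](scalerK (lt0r_neq0 mug0)) -scalerBr mug scalerDl.
    by congr (_ *: _); rewrite /g opprD addrACA subrr addr0.
  rewrite linearZ /= /GRing.scale /= mulrC ler_pdivrMr // mul1r mug.
  by [].
have exL i : exists L : 'Hom(V, R^o), forall f,
    L f = (mu f : R) - (l i (f - (mu f : R) *: r) : R).
  apply: linear_lfun => a f g; rewrite !linearB !linearZ !linearP /= /GRing.scale /=.
  by ring.
have [L LE] := choice exL.
have Lpos i f : Pos f -> 0 <= L i f.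
  by move=> Pf; rewrite LE subr_ge0 lpos.
have Lr i : L i r = 1.
  by rewrite LE mur scale1r subrr linear0 subr0.
pose G i (v : borel_rV R n.+1) := L i (dot_pow (2 * d)%N v) : R.
have bG i : bounded_borel (G i) by exact: bounded_borel_form_moment.
set s := (c ^+ d)^-1 in gd Nlt.
have s0 : 0 < s by rewrite invr_gt0.
have sumle : E (fun v => \sum_i G i v ^+ k.+1) <= N%:R * coord_moment (sigma := sigma) (d * k.+1).
  rewrite (expect_sum sigma_unif) => [|i]; last exact: bounded_borelX.
  rewrite -[X in X%:R]card_ord mulr_natl -sumr_const; apply: ler_sum => i _.
  by have := expect_form_moment k (Lpos i) (Lr i); apply.
(* Some point of the sphere lies below the average bound. *)
have [v [Sv Gv]] : exists v, S v /\ \sum_i G i v ^+ k.+1 < s ^+ k.+1.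
  apply: contrapT => nov; move: Nlt; apply/negP; rewrite -leNgt.
  apply: le_trans sumle; rewrite -(expect_cst sigma_unif (s ^+ k.+1)).
  apply: (le_expect sigma_unif).
  - exact: bounded_borel_cst.
  - by apply: bounded_borel_sum => i; exact: bounded_borelX.
  - by move=> v Sv; rewrite leNgt; apply/negP => vlt; apply: nov; exists v.
have Gs i : G i v < s.
  have G0 j : 0 <= G j v by apply/Lpos/Pos_dot_pow.
  rewrite -(@ltr_pXn2r _ k.+1) ?nnegrE ?(ltW s0) //; apply: le_lt_trans Gv.
  by rewrite (bigD1 i) //= lerDl sumr_ge0 // => j _; rewrite exprn_ge0.
set g := coord_moment d in gd.
have muq : mu (dot_pow (2 * d)%N v) = g.
  rewrite muE /g -(expect_dotX sigma_unif d Sv); apply: eq_expect => x _.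
  rewrite hform_eval_dot_pow; congr (_ ^+ _); apply: eq_bigr => i _.
  by rewrite mulrC.
pose h := (s - g)^-1 *: (g *: r - dot_pow (2 * d)%N v).
have sg0 : 0 < s - g by rewrite subr_gt0.
have Mh0 : mu (g *: r - dot_pow (2 * d)%N v) = 0.
  by rewrite linearB linearZ /= mur muq /GRing.scale /= mulr1 subrr.
(* On forms of mean 0, l_i = - L_i; hence l_i (g r - q_v) = G_i v - g < s - g. *)
have Kh : K h.
  apply/Kl => [|i]; first by rewrite memvZ // memv_ker Mh0.
  rewrite linearZ /= /GRing.scale /= mulrC ler_pdivrMr // mul1r.
  have := LE i (g *: r - dot_pow (2 * d)%N v).
  rewrite Mh0 scale0r subr0 sub0r linearB linearZ /= Lr /GRing.scale /= mulr1.
  move=> LEi; rewrite -[X in X <= _]opprK -LEi opprB lerD2r ltW //.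
  exact: Gs.
(* The value of [h] at v is - (1 - g) / (s - g); were it at least - c^d, then c^d g <= g, against g
   > 0 and c^d > 1. *)
have := Kge h v Kh Sv.
rewrite /h -/(eval_at v _) linearZ linearB linearZ /= /eval_at hform_eval_sumsq //.
rewrite hform_eval_dot_pow (_ : \sum_i _ = 1); last first.
  by rewrite -Sv; apply: eq_bigr => i _; rewrite expr2.
rewrite expr1n mulr1 mulrC ler_pdivlMr // mulNr mulrBr divff ?gt_eqF //.
apply/negP; rewrite -ltNge opprB ltrD2r ltr_pMl.
  by rewrite exprn_egt1 // -lt0n.
exact: coord_moment_gt0.
Qed.

End Sandwich.

(** * Choice of the exponent and of the constants *)

Theorem theorem1p2 (R : realType) :
  exists a0 a1 : R, [/\ 0 < a0, 0 < a1 &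
    forall (n d : nat) (c : R)
      (sigma : {measure set (borel_rV R n) -> \bar R})
      (K : set (hform R n (2 * d))),
      (0 < n)%N -> (0 < d)%N -> 1 < c ->
      uniform_on_sphere sigma ->
      polytope K ->
      translate (Pos1_hform n d sigma) (sumsq_pow R n d) `<=` K ->
      K `<=` dilate (c ^+ d) (translate (Pos1_hform n d sigma) (sumsq_pow R n d)) ->
      exists m : nat,
        a0 * expR (a1 * (n%:R / (c * d%:R))) <= m%:R /\ `I_m #<= facet K].
Proof.
pose e : R := expR 1; have e0 : 0 < e by exact: expR_gt0.
(* The factor 1/e absorbs the loss in rounding n / (2ecd) down to k; it then suffices to find e^k
   facets. *)
exists (expR (- 1)), (2 * e)^-1; split; [exact: expR_gt0|by rewrite invr_gt0 mulr_gt0|].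
move=> n d c sigma K; case: n sigma K => [//|n] sigma K _ d0 c1 us pK Ksup Ksub.
have c0 : 0 < c by exact: lt_trans c1.
have dR0 : 0 < d%:R :> R by rewrite ltr0n.
have [N [facetN HN]] := sandwich_facets us c1 d0 pK Ksup Ksub.
exists (maxn 1 N); split=> //; rewrite -expRD.
set y := n.+1%:R / (c * d%:R).
have y0 : 0 <= y by rewrite divr_ge0 // mulr_ge0 // ltW.
have z0 : 0 <= (2 * e)^-1 * y by rewrite mulr_ge0 // invr_ge0 mulr_ge0 // ltW.
pose k := Num.truncn ((2 * e)^-1 * y).
have /andP[kle klt] : k%:R <= (2 * e)^-1 * y < k.+1%:R by exact: truncn_itv.
have kz : -1 + (2 * e)^-1 * y <= k%:R by move: klt; rewrite -natr1; lra.
apply: le_trans (_ : expR k%:R <= _); first by rewrite ler_expR.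
(* For k = 0 the single facet from [maxn 1 N] suffices; otherwise the exponent is the new [k.+1]. *)
case: k kle {klt kz} => [_|k kle]; first by rewrite expR0 ler1n leq_max.
have y_ge : 2 * e * k.+1%:R <= y.
  by move: kle; rewrite mulrC ler_pdivlMr ?mulr_gt0 // mulrC.
have n_ge : 2 * e * (d * k.+1)%:R * c <= n.+1%:R.
  move: y_ge; rewrite /y ler_pdivlMr ?mulr_gt0 // natrM.
  by rewrite [X in X <= _ -> _](_ : _ = 2 * e * (d%:R * k.+1%:R) * c) //; ring.
have n0 : 0 < n.+1%:R :> R by rewrite ltr0n.
(* Needed at m = d, for the hypothesis of [sandwich_facets], and at m = d (k+1), for its
   conclusion. *)
have ratio m : (m <= d * k.+1)%N -> (2 * m)%:R / n.+1%:R <= (e * c)^-1.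
  move=> mk; rewrite ler_pdivrMr // mulrC ler_pdivlMr ?mulr_gt0 //.
  apply: le_trans n_ge; rewrite natrM.
  rewrite [X in X <= _](_ : _ = 2 * e * c * m%:R); last by ring.
  rewrite [X in _ <= X](_ : _ = 2 * e * c * (d * k.+1)%:R); last by ring.
  by rewrite ler_pM2l ?ler_nat // !mulr_gt0.
have momle m : (m <= d * k.+1)%N -> coord_moment (sigma := sigma) m <= (e * c)^-1 ^+ m.
  move=> mk; apply: le_trans (coord_moment_le us m) _.
  by rewrite lerXn2r ?nnegrE ?divr_ge0 ?invr_ge0 ?mulr_ge0 ?ratio // ltW.
have e1 : 1 < e by rewrite -expR0 ltr_expR.
have gd : coord_moment (sigma := sigma) d < (c ^+ d)^-1.
  apply: le_lt_trans (momle d _) _; first by rewrite leq_pmulr.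
  rewrite invfM exprMn !exprVn -[X in _ < X]mul1r ltr_pM2r ?invr_gt0 ?exprn_gt0 //.
  by rewrite invf_lt1 ?exprn_gt0 // exprn_egt1 // -lt0n.
have := HN k gd.
have := momle _ (leqnn _) => h1 h2.
have h3 : (c ^+ d)^-1 ^+ k.+1 <= N%:R * (e * c)^-1 ^+ (d * k.+1).
  by apply: le_trans h2 _; rewrite ler_wpM2l.
apply: (@le_trans _ _ N%:R); last by rewrite ler_nat leq_maxr.
(* The powers of c cancel, leaving N >= e^(d (k+1)) >= e^(k+1). *)
move: h3; rewrite invfM exprMn -exprVn -exprM mulrA ler_pMl ?exprn_gt0 ?invr_gt0 //.
rewrite exprVn ler_pdivlMr ?exprn_gt0 // mul1r; apply: le_trans.
rewrite -[k.+1%:R]mulr1 expRM_natl.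
by rewrite ler_weXn2l ?(ltW e1) // leq_pmull.
Qed.
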